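(* Let $G$ be a connected graph with vertex set $[n]=\{1,\ldots,n\}$ and let $A=[a_{i,j}]$ be a real symmetric (entrywise) nonnegative matrix of order $n$. If each row of $A$ has at most one zero off-diagonal entry, and $G$ is not a path, then there is a path $P$ with $V(P)=V(G)$ such that $$\sum_{1\le i<j\le n} d_G(i,j)\,a_{i,j}< \sum_{1\le i<j\le n} d_P(i,j)\,a_{i,j}.$$
   Context: Graphs are finite, simple and undirected; a graph of order $n$ has vertex set $[n]=\{1,\ldots,n\}$. For a connected graph $G$, $d_G(i,j)$ denotes the distance (number of edges of a shortest path) between the vertices $i$ and $j$ in $G$. ''$G$ is a path'' means $G$ is isomorphic to the path graph $P_n$ of order $n$. A path $P$ with $V(P)=V(G)$ is a graph on the vertex set $[n]$ that is isomorphic to $P_n$; $P$ need not be a subgraph of $G$. *)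

(* Defs.v *)
From mathcomp Require Import all_boot.

Set Implicit Arguments.
Unset Strict Implicit.
Unset Printing Implicit Defensive.

Record sgraph (T : finType) := SGraph {
  edge :> rel T;
  edge_sym : symmetric edge;
  edge_irr : irreflexive edge
}.

Definition connected (T : finType) (G : sgraph T) : Prop :=
  forall x y : T, connect G x y.

(* [path G x p] reads [x :: p] as a sequence of consecutively adjacent
   vertices, so [size p] is its number of edges. *)
Definition has_path (T : finType) (G : sgraph T) (x y : T) (k : nat) : bool :=
  [exists p : k.-tuple T,
     [&& path G x p, uniq (x :: p) & last x p == y]].

(* A path with k edges has k.+1 distinct vertices, so only k < #|T| need be
   searched; the value is the junk #|T| if y is not reachable from x. *)
Definition dist (T : finType) (G : sgraph T) (x y : T) : nat :=
  find (has_path G x y) (iota 0 #|T|).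

Definition isomorphic (S T : finType) (G : sgraph S) (H : sgraph T) : Prop :=
  exists f : S -> T, bijective f /\ forall x y : S, G x y = H (f x) (f y).

Definition path_rel (n : nat) : rel 'I_n :=
  fun i j => (i.+1 == j :> nat) || (j.+1 == i :> nat).

Lemma path_rel_sym (n : nat) : symmetric (@path_rel n).
Proof. by move=> i j; rewrite /path_rel orbC. Qed.

Lemma path_rel_irr (n : nat) : irreflexive (@path_rel n).
Proof. by move=> i; rewrite /path_rel orbb; apply/negbTE; rewrite gtn_eqF. Qed.

Definition path_graph (n : nat) : sgraph 'I_n :=
  SGraph (@path_rel_sym n) (@path_rel_irr n).

Definition is_path (n : nat) (G : sgraph 'I_n) : Prop :=
  isomorphic G (path_graph n).

(* Main.v *)
Require Import Defs.
From mathcomp Require Import all_boot all_order all_algebra.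
From mathcomp Require Import reals.
From mathcomp Require Import zify lra.

Set Implicit Arguments.
Unset Strict Implicit.
Unset Printing Implicit Defensive.

Import Order.TTheory GRing.Theory Num.Theory.
Local Open Scope ring_scope.

(** The path [P] is handled as the duplicate-free sequence of its vertices, in
which the distance of two vertices is the gap between their positions.

The heart of the matter is that such a sequence can be built vertex by vertex,
for any connected [G] and any nonnegative weights ([wsum_extend]).  Suppose
that a set of vertices is already arranged in a sequence [s], and that [z] is a
new vertex adjacent to some [c] in the set.  Since [d_G(z, v) <= 1 + d_G(c, v)],
the [G]-sum is at most what it would be if the weight of each pair [{z, v}]
were moved to [{c, v}], up to the sum of these weights; so [s] is chosen by
induction for the weights modified in this way ([transfer]).  It remains to
place [z] so that the distances from [z] are, in weighted sum, at least one
more than the distances from [c].  If [k] vertices of [s] lie before [c] and [l]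
after it, putting [z] at the front with weight [l] and at the back with weight
[k] achieves this on average, for every vertex [v] separately ([end_average]);
hence one of the two ends works ([attach_end]).

Strictness comes from the vertex [c] itself: if it is not an end of [s], its
average distance to [z] becomes at least 2.  So when some vertex [c] of [G] has
three neighbours [x], [y], [w], one starts from the sequence [y c w], gains
strictly when adding [x] provided that [a_(c,x) > 0], and never loses this gain
afterwards ([branch_path_better]).  Two of the three neighbours are enough to
find such an [x], because row [c] has at most one zero.

If no vertex has three neighbours, a longest path of [G] must be Hamiltonian,
and as [G] is not a path its two ends are adjacent: [G] is a cycle
([branch_or_cycle]).  Deleting an edge of this cycle yields a path in which
distances are no smaller, and the ends of the deleted edge get further apart
([closed_path_better]).  Of the two cycle edges at a given vertex, one has
positive weight. *)

(** * Distances in a connected graph *)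

Lemma dist_le_size (T : finType) (G : sgraph T) (x : T) (p : seq T) :
  path G x p -> (dist G x (last x p) <= size p)%N.
Proof.
case/shortenP => p' Gp' Up' sub_p'; apply: (@leq_trans (size p')); last first.
  by apply: uniq_leq_size sub_p'; case/andP: Up'.
have ltp' : (size p' < #|T|)%N.
  by rewrite -[(size p').+1]/(size (x :: p')) -(card_uniqP Up') max_card.
rewrite /dist leqNgt; apply/negP => /(before_find 0%N).
rewrite nth_iota // add0n => /negbT/negP[]; apply/existsP; exists (in_tuple p').
by rewrite Gp' Up' eqxx.
Qed.

Lemma dist_attained (T : finType) (G : sgraph T) (x y : T) :
  (dist G x y < #|T|)%N ->
  exists p, [/\ path G x p, last x p = y & size p = dist G x y].
Proof.
move=> lt_d; have Hp : has (has_path G x y) (iota 0 #|T|).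
  by rewrite has_find size_iota.
move: (nth_find 0%N Hp); rewrite nth_iota // add0n.
by case/existsP=> p /and3P[Gp _ /eqP lp]; exists p; rewrite size_tuple.
Qed.

Lemma dist_path (T : finType) (G : sgraph T) (x y : T) :
  connected G ->
  exists p, [/\ path G x p, last x p = y & size p = dist G x y].
Proof.
move=> /(_ x y)/connectP[p0 Gp0 ->]; apply: dist_attained.
have [p Gp Up _] := shortenP Gp0.
apply: leq_ltn_trans (dist_le_size Gp) _.
by rewrite -[(size p).+1]/(size (x :: p)) -(card_uniqP Up) max_card.
Qed.

Lemma dist_refl (T : finType) (G : sgraph T) (x : T) : dist G x x = 0%N.
Proof. by have := @dist_le_size _ G x [::] isT; rewrite leqn0 => /eqP. Qed.

(** This bound drives the induction on the set of vertices already placed.  It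
allows distances to be taken in the whole of [G] throughout, so that the
subgraph induced by that set never needs to be considered. *)
Lemma dist_edge (T : finType) (G : sgraph T) (z c v : T) :
  connected G -> G z c -> (dist G z v <= (dist G c v).+1)%N.
Proof.
move=> cG zc; have [p [Gp <- <-]] := dist_path c v cG.
by have := @dist_le_size _ G z (c :: p); rewrite /= zc; apply.
Qed.

Lemma dist_sym (T : finType) (G : sgraph T) (x y : T) :
  connected G -> dist G x y = dist G y x.
Proof.
move=> cG; wlog suff : x y / (dist G x y <= dist G y x)%N.
  by move=> H; apply/eqP; rewrite eqn_leq !H.
have [p [Gp lp <-]] := dist_path y x cG.
have Gr : path G x (rev (belast y p)).
  by rewrite -lp rev_path (eq_path (e' := G)) // => u v; rewrite edge_sym.
have /= := dist_le_size Gr; rewrite size_rev size_belast.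
by case: p lp {Gp Gr} => [|a p] /= lp; rewrite ?lp // rev_cons last_rcons.
Qed.

(** * Position gaps in a sequence *)

Definition posdist (T : eqType) (s : seq T) (u v : T) : nat :=
  (index u s - index v s) + (index v s - index u s).

Lemma posdist_sym (T : eqType) (s : seq T) (u v : T) :
  posdist s u v = posdist s v u.
Proof. by rewrite /posdist addnC. Qed.

Lemma posdist_refl (T : eqType) (s : seq T) (u : T) : posdist s u u = 0%N.
Proof. by rewrite /posdist subnn. Qed.

Lemma posdist_cons (T : eqType) (z : T) (s : seq T) :
  z \notin s -> {in s &, posdist (z :: s) =2 posdist s}.
Proof.
move=> zs u v us vs; rewrite /posdist /=.
have /negbTE-> : z != u by apply: contraNneq zs => ->.
have /negbTE-> : z != v by apply: contraNneq zs => ->.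
by rewrite !subSS.
Qed.

Lemma posdist_rcons (T : eqType) (z : T) (s : seq T) :
  {in s &, posdist (rcons s z) =2 posdist s}.
Proof.
by move=> u v us vs; rewrite /posdist -cats1 !index_cat us vs.
Qed.

(** A factor of a path of [G] is a walk in [G]. *)
Lemma dist_le_posdist (T : finType) (G : sgraph T) (s : seq T) :
  connected G -> sorted G s -> {in s &, forall u v, (dist G u v <= posdist s u v)%N}.
Proof.
move=> cG; case: s => // x p Gp u v us vs.
wlog le_uv : u v us vs / (index u (x :: p) <= index v (x :: p))%N.
  move=> H; have [/H->//|/ltnW le_vu] := leqP (index u (x :: p)) (index v (x :: p)).
  by rewrite dist_sym // posdist_sym H.
set s := x :: p in Gp us vs le_uv *.
have Gn i : (i.+1 < size s)%N -> G (nth x s i) (nth x s i.+1).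
  by move=> lt_i; apply/(sortedP x).
have step j i : (i + j < size s)%N -> (dist G (nth x s i) (nth x s (i + j)) <= j)%N.
  elim: j i => [|j IH] i lt_ij; first by rewrite addn0 dist_refl.
  apply: leq_trans (dist_edge _ cG (Gn i _)) _; first lia.
  by rewrite ltnS -addSnnS IH // addSnnS.
have := step (index v s - index u s)%N (index u s).
rewrite subnKC // index_mem => /(_ vs).
by rewrite !nth_index // => /leq_trans-> //; rewrite /posdist leq_addl.
Qed.

(** * Weighted sums of distances *)

(** The sum runs over ordered pairs and the weights need not be symmetric, so
that the sum over [i < j] of the theorem is an instance, with weights that
vanish off the upper triangle. *)
Definition wsum (R : realFieldType) (T : eqType) (d : T -> T -> nat)
    (B : T -> T -> R) (s : seq T) : R :=
  \sum_(u <- s) \sum_(v <- s) (d u v)%:R * B u v.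

Lemma wsum_perm (R : realFieldType) (T : eqType) d (B : T -> T -> R) s t :
  perm_eq s t -> wsum d B s = wsum d B t.
Proof.
move=> st; rewrite /wsum (perm_big _ st) /=.
by apply: eq_bigr => u _; apply: perm_big.
Qed.

Lemma eq_wsum (R : realFieldType) (T : eqType) d d' (B : T -> T -> R) s :
  {in s &, d =2 d'} -> wsum d B s = wsum d' B s.
Proof.
by move=> dd'; apply: eq_big_seq => u us; apply: eq_big_seq => v vs; rewrite dd'.
Qed.

Lemma wsum_le (R : realFieldType) (T : eqType) d d' (B : T -> T -> R) s :
  (forall u v, 0 <= B u v) -> {in s &, forall u v, (d u v <= d' u v)%N} ->
  wsum d B s <= wsum d' B s.
Proof.
move=> B0 dd'; rewrite /wsum big_seq [leRHS]big_seq.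
apply: ler_sum => u us; rewrite big_seq [leRHS]big_seq.
by apply: ler_sum => v vs; rewrite ler_wpM2r // ler_nat dd'.
Qed.

Lemma wsum_lt (R : realFieldType) (T : eqType) d d' (B : T -> T -> R) s x y :
  (forall u v, 0 <= B u v) -> uniq s -> x \in s -> y \in s ->
  {in s &, forall u v, (d u v <= d' u v)%N} ->
  (d x y < d' x y)%N -> 0 < B x y -> wsum d B s < wsum d' B s.
Proof.
move=> B0 Us xs ys dd' ltd Bxy.
have le1 u v : u \in s -> v \in s -> (d u v)%:R * B u v <= (d' u v)%:R * B u v.
  by move=> us vs; rewrite ler_wpM2r // ler_nat dd'.
have leR u : u \in s ->
    \sum_(v <- s) (d u v)%:R * B u v <= \sum_(v <- s) (d' u v)%:R * B u v.
  by move=> us; rewrite big_seq [leRHS]big_seq; apply: ler_sum => v /(le1 u v us).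
rewrite /wsum (bigD1_seq x) //= [ltRHS](bigD1_seq x) //=; apply: ltr_leD.
  rewrite (bigD1_seq y) //= [ltRHS](bigD1_seq y) //=.
  apply: ltr_leD; first by rewrite ltr_pM2r // ltr_nat.
  rewrite big_seq_cond [leRHS]big_seq_cond.
  by apply: ler_sum => v /andP[/(le1 x v xs)].
rewrite big_seq_cond [leRHS]big_seq_cond.
by apply: ler_sum => u /andP[/leR].
Qed.

Lemma wsum_cons (R : realFieldType) (T : eqType) d (B : T -> T -> R) z s :
  (forall u v, d u v = d v u) -> d z z = 0%N ->
  wsum d B (z :: s) = wsum d B s + \sum_(v <- s) (d z v)%:R * (B z v + B v z).
Proof.
move=> dsym dz; rewrite /wsum !big_cons dz mul0r add0r.
under [X in _ + X]eq_bigr => u _ do rewrite big_cons.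
under [X in _ = _ + X]eq_bigr => v _ do rewrite mulrDr.
rewrite !big_split /= addrA addrC; congr (_ + (_ + _)).
by apply: eq_bigr => v _; rewrite dsym.
Qed.

(** * Adding a vertex at an end of a path *)

(** The weights after contracting [z] into [c].  Both weights of the pair
[{z, v}] go to the single ordered pair [(c, v)], which is harmless since
[wsum] is only applied to symmetric distances; the weight that lands on [(c, c)]
is multiplied by a zero distance. *)
Definition transfer (R : realFieldType) (T : eqType) (B : T -> T -> R)
    (z c u v : T) : R :=
  B u v + (u == c)%:R * (B z v + B v z).

Lemma wsum_transfer (R : realFieldType) (T : eqType) d (B : T -> T -> R) z c s :
  uniq s -> c \in s ->
  wsum d (transfer B z c) s
    = wsum d B s + \sum_(v <- s) (d c v)%:R * (B z v + B v z).
Proof.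
move=> Us cs; rewrite /wsum (bigD1_seq c) //= [in RHS](bigD1_seq c) //=.
rewrite addrAC -big_split /=; congr (_ + _).
  by apply: eq_bigr => v _; rewrite /transfer eqxx mul1r mulrDr.
apply: eq_bigr => u /negbTE uc; apply: eq_bigr => v _.
by rewrite /transfer uc mul0r addr0.
Qed.

(** The position [i] stands for a vertex [v] and [k] for [c], in a sequence
with [k] vertices before [c] and [l] after it; a vertex at the front is at
distance [i.+1] from [v], and one at the back at distance [(k + l).+1 - i].
The surplus of the right-hand side is [2 l i] if [i <= k] and
[2 k (k + l - i)] if [k <= i]; at [i = k], if [k] and [l] are positive, this
is [2 k l >= k + l]. *)
Lemma end_average (k l i : nat) : (i <= k + l)%N ->
  ((k + l) * (1 + (k - i + (i - k)) + ((i == k) && (0 < k) && (0 < l)))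
     <= l * i.+1 + k * ((k + l).+1 - i))%N.
Proof.
move=> le_i; have [lt_ik|lt_ki|->] := ltngtP i k => /=; nia.
Qed.

(** By [end_average], the weighted mean of the two sums obtained with [z] at the
front and at the back is large enough, hence so is one of them.  The boolean
term is the extra gain at [c] when [c] is not an end of [s]. *)
Lemma attach_end (R : realFieldType) (T : eqType) (b : T -> R) (s : seq T) (c z : T) :
  (forall v, 0 <= b v) -> uniq s -> c \in s -> z \notin s ->
  exists s', [/\ perm_eq s' (z :: s), {in s &, posdist s' =2 posdist s} &
    \sum_(v <- s) (posdist s c v).+1%:R * b v
      + ((0 < index c s) && (index c s < (size s).-1))%N%:R * b c
    <= \sum_(v <- s) (posdist s' z v)%:R * b v].
Proof.
move=> b0 Us cs zs; set k := index c s; set l := ((size s).-1 - k)%N.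
have lt_k : (k < size s)%N by rewrite index_mem.
have def_s : size s = (k + l).+1 by lia.
have dL v : v \in s -> posdist (z :: s) z v = (index v s).+1.
  move=> vs; rewrite /posdist /= eqxx.
  by have /negbTE-> : z != v by apply: contraNneq zs => ->.
have dR v : v \in s -> posdist (rcons s z) z v = ((k + l).+1 - index v s)%N.
  move=> vs; rewrite /posdist -cats1 !index_cat vs (negbTE zs) /= eqxx addn0 def_s.
  by have := vs; rewrite -index_mem; lia.
set g := (X in (nat_of_bool X)%:R * b c).
(* The distance from z that is aimed at, with the gain at c included. *)
pose w v := (1 + posdist s c v + ((v == c) && g))%N.
have -> : \sum_(v <- s) (posdist s c v).+1%:R * b v + g%:R * b c =
          \sum_(v <- s) (w v)%:R * b v.
  under [RHS]eq_bigr => v _ do rewrite natrD mulrDl.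
  rewrite big_split /= ; congr (_ + _).
  rewrite (bigD1_seq c) //= eqxx big1 ?addr0 // => v /negbTE->.
  by rewrite mul0r.
pose X := \sum_(v <- s) (w v)%:R * b v; rewrite -/X.
pose L := \sum_(v <- s) (posdist (z :: s) z v)%:R * b v.
pose R' := \sum_(v <- s) (posdist (rcons s z) z v)%:R * b v.
have key : (k + l)%:R * X <= l%:R * L + k%:R * R'.
  rewrite !mulr_sumr -big_split /= big_seq [leRHS]big_seq.
  apply: ler_sum => v vs; rewrite !mulrA -mulrDl -!natrM -natrD ler_wpM2r //.
  rewrite ler_nat dL // dR // /w.
  have -> : (v == c) && g = (index v s == k) && (0 < k)%N && (0 < l)%N.
    have -> : (v == c) = (index v s == k).
      apply/eqP/eqP => [->//|e]; rewrite -(nth_index c vs) e.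
      exact: nth_index.
    by rewrite /g -andbA /l subn_gt0.
  by apply: end_average; have := vs; rewrite -index_mem; lia.
have [leL|ltL] := leP X L.
  exists (z :: s); split=> //; exact: posdist_cons.
exists (rcons s z); split; first by rewrite perm_rcons.
  exact: posdist_rcons.
have [k0|k0] := posnP k; last first.
  have k0' : 0 < k%:R :> R by rewrite ltr0n.
  have l0' : 0 <= l%:R :> R by rewrite ler0n.
  rewrite -(ler_pM2l k0') -/R'; rewrite natrD in key.
  nra.
(* The mean puts weight k = 0 on the back; it says nothing when l = 0 too,
   but the inequality then holds at the front vertex by vertex. *)
move: ltL; rewrite ltNge => /negP[].
rewrite /X /L big_seq [leRHS]big_seq; apply: ler_sum => v vs.
rewrite ler_wpM2r // ler_nat dL // /w /g k0 andbF addn0 add1n.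
by rewrite /posdist -/k k0 sub0n subn0.
Qed.

(** The surplus of [s] over [G] for the contracted weights is inherited by the
longer sequence for the original weights, and increased by the gain at [c]. *)
Lemma wsum_extend (R : realFieldType) (T : finType) (G : sgraph T)
    (B : T -> T -> R) (s : seq T) (z c : T) :
  connected G -> (forall u v, 0 <= B u v) -> uniq s -> c \in s -> z \notin s ->
  G z c ->
  exists2 s', perm_eq s' (z :: s) &
    wsum (dist G) B (z :: s)
      + (wsum (posdist s) (transfer B z c) s - wsum (dist G) (transfer B z c) s)
      + ((0 < index c s) && (index c s < (size s).-1))%N%:R * (B z c + B c z)
    <= wsum (posdist s') B s'.
Proof.
move=> cG B0 Us cs zs zc; pose b v := B z v + B v z.
have b0 v : 0 <= b v by rewrite addr_ge0.
have [s' [ps' ds' le_s']] := attach_end b0 Us cs zs.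
exists s' => //; rewrite (wsum_perm _ _ ps').
rewrite !wsum_cons ?posdist_refl ?dist_refl //; try exact: posdist_sym; last first.
  by move=> u v; apply: dist_sym.
rewrite (eq_wsum _ ds') !wsum_transfer // -/(b c).
have le_d : \sum_(v <- s) (dist G z v)%:R * (B z v + B v z) <=
     \sum_(v <- s) ((dist G c v).+1)%:R * b v.
  by apply: ler_sum => v _; apply: ler_wpM2r (b0 v) _ _ _; rewrite ler_nat dist_edge.
move: le_s' le_d; rewrite -/(b).
have sumS (f : T -> nat) :
    \sum_(v <- s) (f v).+1%:R * b v = \sum_(v <- s) (f v)%:R * b v + \sum_(v <- s) b v.
  by rewrite -big_split /=; apply: eq_bigr => v _; rewrite mulrSr mulrDl mul1r.
rewrite !sumS /b; lra.
Qed.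

(** * Graphs with a vertex of degree at least three *)

Lemma boundary_edge (T : finType) (G : sgraph T) (s : seq T) (x : T) :
  connected G -> x \in s -> uniq s -> (size s < #|T|)%N ->
  exists z c, [/\ z \notin s, c \in s & G z c].
Proof.
move=> cG xs Us lt_s.
have [y ys] : exists y, y \notin s.
  apply/existsP; rewrite -negb_forall; apply: contraL lt_s => /forallP H.
  rewrite -leqNgt -(card_uniqP Us); apply/subset_leq_card/subsetP => u _.
  by have := H u.
have /connectP[p Gp def_y] := cG y x.
elim: p y ys Gp def_y => [|w p IH] y ys /= => [_ def_y|/andP[yw Gp]].
  by rewrite -def_y xs in ys.
have [ws _|ws] := boolP (w \in s); first by exists y, w.
exact: IH.
Qed.

(** The sequence [y c w] is a path of [G] with [c] inside, so that adding [x] next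
brings a positive gain; [transfer] only increases weights, hence the
hypothesis on the weights of [{c, x}] is preserved by contraction of the
vertices that are added later. *)
Lemma branch_path_better (R : realFieldType) (T : finType) (G : sgraph T)
    (B : T -> T -> R) (c x y w : T) :
  connected G -> (forall u v, 0 <= B u v) ->
  uniq [:: x; y; c; w] -> G c x -> G c y -> G c w -> 0 < B x c + B c x ->
  exists s, [/\ uniq s, size s = #|T| & wsum (dist G) B s < wsum (posdist s) B s].
Proof.
move=> cG B0 Ustar cx cy cw Bcx.
(* The weights are quantified inside, since adding a vertex to t calls for
   the strict inequality on t with contracted weights. *)
pose good (t : seq T) := uniq t /\ forall B : T -> T -> R,
  (forall u v, 0 <= B u v) -> 0 < B x c + B c x ->
  exists2 s, perm_eq s t & wsum (dist G) B s < wsum (posdist s) B s.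
have transfer_ge0 (D : T -> T -> R) z e : (forall u v, 0 <= D u v) ->
    forall u v, D u v <= transfer D z e u v.
  by move=> D0 u v; rewrite lerDl mulr_ge0 ?ler0n ?addr_ge0.
have base : good [:: x; y; c; w].
  split=> // {B0 Bcx}D D0 Dcx.
  have [xs Us] : x \notin [:: y; c; w] /\ uniq [:: y; c; w] by apply/andP.
  have cs : c \in [:: y; c; w] by rewrite !inE eqxx orbT.
  have [|s ps les] := wsum_extend cG D0 Us cs xs; first by rewrite edge_sym.
  exists s => //; rewrite (wsum_perm (dist G) _ ps); apply: lt_le_trans les.
  have yc : y == c = false.
    by apply/eqP => e; move: Us; rewrite e /= inE eqxx.
  rewrite /= yc eqxx /= mul1r -addrA ltrDl ltr_wpDl // subr_ge0.
  apply: wsum_le => [u v|]; first exact: le_trans (transfer_ge0 _ _ _ D0 _ _).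
  by apply: dist_le_posdist; rewrite //= edge_sym cy cw.
have grow t : good t -> c \in t -> (size t < #|T|)%N ->
    exists z, good (z :: t).
  move=> [Ut gt] ct lt_t; have [z [e [zt et ze]]] := boundary_edge cG ct Ut lt_t.
  exists z; split=> /= [|D D0 Dcx]; first by rewrite zt.
  have le_D := transfer_ge0 D z e D0.
  have [||s ps lts] := gt (transfer D z e).
  - by move=> u v; apply: le_trans (le_D u v).
  - by apply: lt_le_trans Dcx _; rewrite lerD.
  have Us : uniq s by rewrite (perm_uniq ps).
  have es : e \in s by rewrite (perm_mem ps).
  have zs : z \notin s by rewrite (perm_mem ps).
  have [s' ps' les'] := wsum_extend cG D0 Us es zs ze.
  exists s'; first by apply: perm_trans ps' _; rewrite perm_cons.
  rewrite (wsum_perm (dist G) _ ps'); apply: lt_le_trans les'.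
  rewrite -addrA ltrDl ltr_pwDl ?subr_gt0 //.
  by rewrite mulr_ge0 ?ler0n ?addr_ge0.
have full m : forall t, good t -> c \in t -> (#|T| - size t = m)%N ->
    exists2 t', good t' & size t' = #|T|.
  elim: m => [|m IH] t gt ct def_m.
    exists t => //; apply/eqP; rewrite eqn_leq.
    by rewrite -(card_uniqP gt.1) max_card /= (card_uniqP gt.1) -subn_eq0 def_m.
  have [|z gz] := grow t gt ct; first lia.
  apply: IH gz _ _; first by rewrite inE ct orbT.
  by rewrite /= subnS def_m.
have [|t [Ut gt] szt] := full _ _ base _ erefl; first by rewrite !inE eqxx !orbT.
have [s ps lts] := gt B B0 Bcx; exists s.
by rewrite (perm_uniq ps) (perm_size ps).
Qed.

(** * Cycles *)

(** The edge that closes the cycle joins the two ends of the sequence, at distance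
1 in [G] but [size p > 1] in the sequence. *)
Lemma closed_path_better (R : realFieldType) (T : finType) (G : sgraph T)
    (B : T -> T -> R) (x : T) (p : seq T) :
  connected G -> (forall u v, 0 <= B u v) -> uniq (x :: p) ->
  path G x p -> G x (last x p) -> (1 < size p)%N ->
  0 < B x (last x p) + B (last x p) x ->
  wsum (dist G) B (x :: p) < wsum (posdist (x :: p)) B (x :: p).
Proof.
move=> cG B0 Up Gp xl szp Bxl; set y := last x p in xl Bxl.
have ys : y \in x :: p by apply: mem_last.
have xs : x \in x :: p by apply: mem_head.
have led := @dist_le_posdist _ G (x :: p) cG Gp.
have ltd : (dist G x y < posdist (x :: p) x y)%N.
  apply: (@leq_ltn_trans 1).
    by have := @dist_le_size _ G x [:: y]; rewrite /= xl; apply.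
  by rewrite /posdist index_head sub0n subn0 add0n /y index_last.
have [Bxy|Bxy] := ltP 0 (B x y); first exact: (wsum_lt B0 Up xs ys).
apply: (wsum_lt B0 Up ys xs) => //; last lra.
by rewrite dist_sym // posdist_sym.
Qed.

(** * Connected graphs without a branch vertex *)

Definition has_branch_vertex (T : finType) (G : sgraph T) : Prop :=
  exists c x y w, [/\ uniq [:: c; x; y; w], G c x, G c y & G c w].

Lemma longest_path (T : finType) (G : sgraph T) :
  exists s, [/\ uniq s, sorted G s &
    forall t, uniq t -> sorted G t -> (size t <= size s)%N].
Proof.
pose P m := [exists t : m.-tuple T, uniq t && sorted G t].
have exP : exists m, P m by exists 0%N; apply/existsP; exists [tuple].
have leP m : P m -> (m <= #|T|)%N.
  case/existsP=> t /andP[Ut _].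
  by rewrite -(size_tuple t) -(card_uniqP Ut) max_card.
case: (ex_maxnP exP leP) => m /existsP[s /andP[Us Gs]] maxm.
exists s; split=> // t Ut Gt; rewrite size_tuple; apply: maxm.
by apply/existsP; exists (in_tuple t); rewrite Ut.
Qed.

(** If a longest path misses a vertex, it has a vertex [c] with a neighbour
outside it.  Then [c] is not an end of the path, which could be extended
otherwise, so [c] also has two neighbours on the path. *)
Lemma branch_or_hamiltonian (T : finType) (G : sgraph T) :
  connected G ->
  has_branch_vertex G \/ exists s, [/\ uniq s, sorted G s & size s = #|T|].
Proof.
move=> cG; have [s [Us Gs maxs]] := longest_path G.
have [lt_s|le_s] := ltnP (size s) #|T|; last first.
  right; exists s; split=> //; apply/eqP.
  by rewrite eqn_leq le_s -(card_uniqP Us) max_card.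
left.
have [x xs] : exists x, x \in s.
  case: s Us Gs maxs lt_s => [|x s] _ _ maxs lt_s; last by exists x; rewrite mem_head.
  by have [x _] := card_gt0P lt_s; have := maxs [:: x] isT isT.
have [z [c [zs cs zc]]] := boundary_edge cG xs Us lt_s.
case/splitPr: cs Us Gs maxs zs {xs lt_s} => p q Us Gs maxs zs.
case/lastP: p Us Gs maxs zs => [|p u] Us Gs maxs zs.
  move: Gs => /= Gs; have := maxs (z :: c :: q).
  by rewrite cons_uniq zs Us /= zc Gs ltnn => /(_ isT isT).
case: q Us Gs maxs zs => [|v q] Us Gs maxs zs.
  have Ut : uniq (rcons p u ++ [:: c; z]).
    by rewrite -(cat1s c) catA cats1 rcons_uniq zs Us.
  have Gt : sorted G (rcons p u ++ [:: c; z]).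
    by rewrite sorted_cat_cons /= edge_sym zc -(cats1 _ c) Gs.
  by have := maxs _ Ut Gt; rewrite !size_cat /= leq_add2l.
move: Us Gs zs; rewrite cat_rcons sorted_cat_cons /= => Us /and4P[_ uc cv _] zs.
exists c, u, v, z; split=> //; [|by rewrite edge_sym|by rewrite edge_sym].
move: Us zs; rewrite cat_uniq mem_cat negb_or => /and3P[_ _ Us] /andP[_ zs].
move: Us zs; rewrite /= !inE !negb_or.
case/and3P=> /and3P[neq_uc neq_uv _] /andP[neq_cv _] _.
case/and4P=> neq_zu neq_zc neq_zv _; rewrite neq_cv neq_uv eq_sym neq_uc.
by rewrite [c == z]eq_sym neq_zc [u == z]eq_sym neq_zu eq_sym neq_zv.
Qed.

Lemma position_bij (n : nat) (s : seq 'I_n) :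
  uniq s -> size s = n ->
  exists2 f : 'I_n -> 'I_n, bijective f & forall x, f x = index x s :> nat.
Proof.
move=> Us szs.
have ss x : x \in s.
  have /(@subset_cardP _ (mem s) predT) : #|s| = #|'I_n|.
    by rewrite (card_uniqP Us) card_ord.
  by move/(_ (subset_predT _))->.
have lt_s x : (index x s < n)%N by rewrite -[X in (_ < X)%N]szs index_mem.
exists (fun x => Ordinal (lt_s x)) => //; apply: injF_bij => x y [e].
by rewrite -(nth_index x (ss x)) e nth_index.
Qed.

(** An edge changes the position by one, so a walk is at least as long as the gap
between the positions of its ends. *)
Lemma path_of_seq (n : nat) (s : seq 'I_n) :
  uniq s -> size s = n ->
  exists P : sgraph 'I_n,
    is_path P /\ forall x y, (posdist s x y <= dist P x y)%N.
Proof.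
move=> Us szs; have [f f_bij def_f] := position_bij Us szs.
pose P := SGraph (edge := fun x y => path_rel (f x) (f y))
  (fun x y => path_rel_sym _ _) (fun x => path_rel_irr _).
exists P; split; first by exists f.
have le_path p x : path P x p -> (posdist s x (last x p) <= size p)%N.
  elim: p x => [|y p IH] x /=; first by rewrite posdist_refl.
  case/andP=> Pxy /IH; move: Pxy; rewrite /= /path_rel /= !def_f /posdist.
  by case/orP=> /eqP; lia.
move=> x y; have [/dist_attained[p [Pp <- <-]]|] := ltnP (dist P x y) #|'I_n|.
  exact: le_path.
(* The default value n of dist exceeds every gap between positions. *)
rewrite card_ord; apply: leq_trans; rewrite /posdist -!def_f.
by have := ltn_ord (f x); have := ltn_ord (f y); lia.
Qed.

(** Take a Hamiltonian path [s].  As [G] is not a path, it has an edge [x y] between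
vertices that are not consecutive in [s], and if [x] or [y] is not an end of
[s] then it has three neighbours.  Otherwise this edge closes [s] into a cycle. *)
Lemma branch_or_cycle (n : nat) (G : sgraph 'I_n) :
  connected G -> ~ is_path G ->
  has_branch_vertex G \/ exists x p, [/\ uniq (x :: p), path G x p, G x (last x p),
    size (x :: p) = n & (1 < size p)%N].
Proof.
move=> cG notP; have [|[s [Us Gs]]] := branch_or_hamiltonian cG; first by left.
rewrite card_ord => szs; have [f f_bij def_f] := position_bij Us szs.
have lt_s x : (index x s < n)%N by rewrite -def_f.
have ss x : x \in s by rewrite -index_mem szs.
have Gn x i : (i.+1 < n)%N -> G (nth x s i) (nth x s i.+1).
  by move=> lt_i; apply/(sortedP x); rewrite ?szs.
have [/existsP[x /existsP[y /andP[Gxy lt_xy]]]|noedge] :=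
  boolP [exists x, exists y, G x y && ((index x s).+1 < index y s)%N]; last first.
  case: notP; exists f; split=> // x y; rewrite /= /path_rel !def_f.
  have sub u v : (index u s).+1 = index v s -> G u v.
    move=> e; have := Gn u (index u s); rewrite e => /(_ (lt_s v)).
    by rewrite !nth_index.
  have nolong u v : G u v -> (index v s <= (index u s).+1)%N.
    move=> Guv; rewrite leqNgt; apply: contra noedge => lt_uv.
    by apply/existsP; exists u; apply/existsP; exists v; rewrite Guv.
  apply/idP/orP=> [Gxy|[]/eqP/sub//]; last by rewrite edge_sym.
  have := nolong _ _ Gxy; have := nolong y x; rewrite edge_sym Gxy => /(_ isT).
  have : index x s != index y s.
    apply/eqP=> e; move: Gxy; rewrite -(nth_index x (ss y)) -e nth_index //.
    by rewrite edge_irr.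
  by move: (index x s) (index y s) => i j; lia.
have branch_at u w : (0 < index u s)%N -> ((index u s).+1 < n)%N -> G u w ->
    index w s != (index u s).+1 -> (index w s).+1 != index u s -> has_branch_vertex G.
  move=> u_gt0 u_lt Guw wu uw.
  pose a := nth u s (index u s).-1; pose b := nth u s (index u s).+1.
  have ia : index a s = (index u s).-1 by rewrite index_uniq // szs; lia.
  have ib : index b s = (index u s).+1 by rewrite index_uniq // szs.
  exists u, a, b, w; split=> //.
  - apply: (@map_uniq _ _ (index^~ s)).
    rewrite /= !inE ia ib !negb_or.
    have : index u s != index w s.
      apply/eqP=> e; move: Guw; rewrite -(nth_index u (ss w)) -e nth_index //.
      by rewrite edge_irr.
    by lia.
  - have := Gn u (index u s).-1; rewrite prednK // nth_index // edge_sym.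
    by apply; apply: lt_s.
  - by have := Gn u (index u s) u_lt; rewrite nth_index.
have [x0|x_gt0] := posnP (index x s); last first.
  by left; apply: (branch_at x y) => //; have := lt_s y; lia.
have [y_last|y_last] := eqVneq (index y s).+1 n; last first.
  by left; apply: (branch_at y x); rewrite ?(edge_sym G y) //; have := lt_s y; lia.
right; case: s Us Gs szs x0 y_last lt_xy {def_f lt_s Gn branch_at} ss.
  by move=> _ _ _ _ _ _ /(_ x).
move=> z p Up Gp szp x0 y_last lt_xy ss.
have zx : z = x by move: x0 => /=; case: eqVneq.
subst z; have szy : size p = index y (x :: p).
  by apply: succn_inj; apply: etrans szp (esym y_last).
exists x, p; split=> //; last by move: lt_xy; rewrite x0 szy.
by rewrite (last_nth x) szy nth_index.
Qed.

Theorem theorem5 (R : realType) (n : nat) (G : sgraph 'I_n) (A : 'M[R]_n)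
  (G_conn : connected G)
  (A_sym : A^T = A)
  (A_ge0 : forall i j : 'I_n, 0 <= A i j)
  (A_zeros : forall i : 'I_n,
     (#|[set j : 'I_n | (j != i) && (A i j == 0%R)]| <= 1)%N)
  (G_not_path : ~ is_path G) :
  exists P : sgraph 'I_n,
    is_path P /\
    \sum_(i < n) \sum_(j < n | (i < j)%N) (dist G i j)%:R * A i j
      < \sum_(i < n) \sum_(j < n | (i < j)%N) (dist P i j)%:R * A i j.
Proof.
pose B (i j : 'I_n) : R := if (i < j)%N then A i j else 0.
have B0 i j : 0 <= B i j by rewrite /B; case: ifP.
have BA i j : i != j -> B i j + B j i = A i j.
  rewrite /B -val_eqE => /=; case: ltngtP => // _ _; rewrite ?addr0 ?add0r //.
  by rewrite -[in RHS]A_sym mxE.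
have Bpos c x y : uniq [:: c; x; y] -> 0 < B c x + B x c \/ 0 < B c y + B y c.
  rewrite /= !inE negb_or => /and3P[/andP[cx cy] xy _]; rewrite !BA //.
  have [Acx|] := ltP 0 (A c x); [by left|move=> Acx].
  have [Acy|] := ltP 0 (A c y); [by right|move=> Acy].
  have := A_zeros c; rewrite leqNgt => /negP[]; apply/card_gt1P.
  exists x, y; split=> //; rewrite inE eq_sym ?cx ?cy.
    by rewrite eq_le Acx A_ge0.
  by rewrite eq_le Acy A_ge0.
have wsumE d : \sum_(i < n) \sum_(j < n | (i < j)%N) (d i j)%:R * A i j =
    wsum d B (enum 'I_n).
  rewrite /wsum big_enum; apply: eq_bigr => i _.
  rewrite big_enum big_mkcond; apply: eq_bigr => j _.
  by rewrite /B; case: ifP => // _; rewrite mulr0.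
suff [s [Us szs lts]] : exists s : seq 'I_n,
    [/\ uniq s, size s = #|'I_n| & wsum (dist G) B s < wsum (posdist s) B s].
  have [P [isP leP]] : exists P : sgraph 'I_n,
      is_path P /\ forall x y, (posdist s x y <= dist P x y)%N.
    by apply: path_of_seq; rewrite // szs card_ord.
  exists P; split=> //; rewrite !wsumE.
  have ps : perm_eq (enum 'I_n) s.
    rewrite perm_sym; apply: uniq_perm => //; first exact: enum_uniq.
    have [] := uniq_min_size Us (s2 := enum 'I_n) => //.
      by move=> x _; rewrite mem_enum.
    by rewrite szs cardE.
  rewrite !(wsum_perm _ _ ps); apply: lt_le_trans lts _.
  exact: wsum_le.
have [[c [x [y [w [Uc cx cy cw]]]]]|[x [p [Up Gp xl szp p_gt1]]]] :=
    branch_or_cycle G_conn G_not_path.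
  have [|Bcx|Bcy] := Bpos c x y.
  - exact: subseq_uniq (prefix_subseq [:: c; x; y] [:: w]) Uc.
  - apply: (@branch_path_better _ _ G B c x y w) => //; last by rewrite addrC.
    by rewrite -(perm_uniq (s1 := [:: c; x; y; w])) //; apply/permP => q /=; lia.
  - apply: (@branch_path_better _ _ G B c y x w) => //; last by rewrite addrC.
    by rewrite -(perm_uniq (s1 := [:: c; x; y; w])) //; apply/permP => q /=; lia.
case: p Up Gp xl szp p_gt1 => [|y q] // Up Gp xl szp p_gt1.
set w := last x (y :: q) in xl.
have Uxwy : uniq [:: x; w; y].
  have wq : w \in q by rewrite /w; case: (q) p_gt1 => //= a r _; apply: mem_last.
  case/and3P: Up => xyq yq _; rewrite /= !inE negb_or andbT.
  move: xyq; rewrite inE negb_or => /andP[-> xq]; rewrite andbT.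
  by apply/andP; split; [apply: contraNneq xq => ->|apply: contraNneq yq => <-].
(* Both w x and x y are edges of the cycle; delete one of positive weight. *)
have [Bxw|Bxy] := Bpos x w y Uxwy.
  exists (x :: y :: q); rewrite card_ord; split=> //.
  exact: closed_path_better.
move: (Up); rewrite -(rot_uniq 1) rot1_cons => Ur.
exists (y :: rcons q x); rewrite card_ord -rcons_cons; split=> //.
  by rewrite size_rcons.
have Gyq : path G y q by case/andP: Gp.
have Gxy : G x y by case/andP: Gp.
apply: closed_path_better => //.
- by rewrite rcons_path Gyq edge_sym.
- by rewrite last_rcons edge_sym.
- by rewrite size_rcons.
- by rewrite last_rcons addrC.
Qed.
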